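(* For each nonnegative integer $k$, $$1=\sum_{i=0}^k(-1)^i\binom{k}{i}2^{k-i}.$$ *)

(* Defs.v *)
From mathcomp Require Import all_boot all_order all_algebra.

(* Main.v *)
Require Import Defs.
From mathcomp Require Import all_boot all_order all_algebra.
Import GRing.Theory.
Local Open Scope ring_scope.

Theorem proposition2p1 (k : nat) :
  1 = \sum_(0 <= i < k.+1) (-1) ^+ i * 'C(k, i)%:R * 2 ^+ (k - i)%N :> int.
Proof.
(* The sum is the binomial expansion of [(2 - 1) ^+ k]. The selector [{1}] spares the [1] inside
   [-1]; [expr1n] applies because [2 - 1] computes to [1] in [int]. *)
have {1}-> : 1 = (2 - 1) ^+ k :> int by rewrite expr1n.
(* [exprDn] gives the exponent [k - i] to the first summand [2] and [i] to [-1], so the two sums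
   agree term by term up to reordering factors. *)
rewrite exprDn big_mkord; apply: eq_bigr => i _.
by rewrite -[LHS]mulr_natr -mulrA mulrC.
Qed.
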